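(* Let $O$ be an order in $K\subset\mathbb{C}_n$ which is Clifford-Euclidean with respect to the norm. Then the Ford spheres $\mathcal{P}$ of $\operatorname{PSL}_2(O)$ are connected, i.e. the tangency graph of $\mathcal{P}$ is connected.
   Context: $\mathbb{C}_m$ is the real algebra generated by $i_1,\dots,i_{m-1}$ with $i_a^2=-1$, $i_ai_b=-i_bi_a$ ($a\ne b$); $\mathbb{C}_n\subset\mathbb{C}_{n+1}$; $V_m=\{x_0+x_1i_1+\cdots+x_{m-1}i_{m-1}\}$, $|x|^2=\sum x_j^2$. Involutions: $x'$ ($i_a\mapsto -i_a$), $x^*$ (reversal anti-automorphism fixing each $i_a$), $\bar x=(x')^*$; $\Gamma_n$ is the group generated by nonzero elements of $V_n$, and $|x|^2=x\bar x$ for $x\in\Gamma_n$. $\operatorname{SL}_2(\mathbb{C}_n)$: matrices with entries in $\Gamma_n\cup\{0\}$, $ad^*-bc^*=1$, $ab^*,cd^*,c^*a,d^*b\in V_n$, acting on $V_{n+1}\cup\{\infty\}$ by $x\mapsto(ax+b)(cx+d)^{-1}$ and preserving $\mathcal{H}^{n+1}=\{x\in V_{n+1}:x_n>0\}$. $K=\mathbb{Q}[\sqrt{d_1}i_1,\dots,\sqrt{d_{n-1}}i_{n-1}]$ with $d_j$ squarefree positive integers and $d_1y_1^2+\cdots+d_{n-1}y_{n-1}^2$ primitive. $O$ is an order in $K$ (subring which is a full $\mathbb{Z}$-lattice) closed under $*$; $O^{\vartriangleright}=O\cap(\Gamma_n\cup\{0\})$, $\operatorname{Vec}(O)=O\cap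 V_n$. $O$ is Clifford-Euclidean if for all $c,d\in O^{\vartriangleright}$ with $c^{-1}d\in K$ invertible there exist $a\in\operatorname{Vec}(O)$ and $r$ with $d=ca+r$ and $|r|<|c|$. $\operatorname{SL}_2(O)$ is the set of $g\in\operatorname{SL}_2(\mathbb{C}_n)$ with $g,g^{-1}$ having entries in $O$. $S_\infty=\{x\in V_{n+1}:x_n=1\}$ and $\mathcal{P}=\{\gamma(S_\infty):\gamma\in\operatorname{PSL}_2(O)\}$. The tangency graph has vertex set $\mathcal{P}$, with distinct $S,T$ adjacent iff $S\cap T\neq\emptyset$. *)

(* Defs.v *)
(* Mathematical Components, with mathcomp-analysis for the real numbers
   and classical sets. *)
From HB Require Import structures.
From Stdlib Require Import Relation_Operators.
From mathcomp Require Import all_boot all_order all_algebra.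
From mathcomp Require Import boolp classical_sets reals ring.

Set Implicit Arguments.
Unset Strict Implicit.
Unset Printing Implicit Defensive.

Import Order.TTheory GRing.Theory Num.Theory.

Local Open Scope ring_scope.
Local Open Scope classical_set_scope.

Section SymmetricDifference.
Variable T : finType.
Implicit Types A B C : {set T}.

Definition symd A B : {set T} := [set a | (a \in A) (+) (a \in B)]%SET.

Lemma symdC : commutative symd.
Proof. by move=> A B; apply/setP => a; rewrite !inE addbC. Qed.

Lemma symdA : associative symd.
Proof. by move=> A B C; apply/setP => a; rewrite !inE addbA. Qed.

Lemma symd0 A : symd A finset.set0 = A.
Proof. by apply/setP => a; rewrite !inE addbF. Qed.

Lemma sym0d A : symd finset.set0 A = A.
Proof. by rewrite symdC symd0. Qed.

Lemma symdd A : symd A A = finset.set0.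
Proof. by apply/setP => a; rewrite !inE addbb. Qed.

Lemma symdK A : involutive (symd A).
Proof. by move=> B; rewrite symdA symdd sym0d. Qed.

Lemma symd_inj A : injective (symd A).
Proof. exact: inv_inj (symdK A). Qed.

Lemma symd_eq0 A B : (symd A B == finset.set0) = (A == B).
Proof. by rewrite -(inj_eq (@symd_inj A)) symdK symd0 eq_sym. Qed.

End SymmetricDifference.

(* [clifford R m] is C_m.  An element is the family of its coordinates on the
   basis i_A = i_{a_1} ... i_{a_k} for A = {a_1 < ... < a_k}; the generators
   i_1, ..., i_{m-1} are numbered from 0 in 'I_m.-1. *)
Definition clifford (R : realType) (m : nat) : Type :=
  {ffun {set 'I_m.-1} -> R}.

HB.instance Definition _ (R : realType) (m : nat) :=
  GRing.Lmodule.copy (clifford R m) {ffun {set 'I_m.-1} -> R^o}.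

Section CliffordRing.
Variables (R : realType) (m : nat).
Implicit Types (A B C : {set 'I_m.-1}) (x y z : clifford R m).

(* i_A i_B = cl_sign A B i_(A symd B): one factor -1 for each transposition
   of b < a, and one for each square i_a i_a = -1. *)
Definition cl_sign A B : R :=
  \prod_(a in A) \prod_(b in B | (b <= a)%N) -1.

Definition cl_one : clifford R m := [ffun A => (A == finset.set0)%:R].

(* The pairs (A, B) with A symd B = C are the pairs (A, A symd C). *)
Definition cl_mul x y : clifford R m :=
  [ffun C => \sum_A cl_sign A (symd A C) * (x A * y (symd A C))].

Lemma cl_prod_symd A B (P : pred 'I_m.-1) (F : 'I_m.-1 -> R) :
    (forall a, F a * F a = 1) ->
  \prod_(a in symd A B | P a) F a =
  (\prod_(a in A | P a) F a) * \prod_(a in B | P a) F a.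
Proof.
move=> F2; rewrite big_mkcond [X in X * _]big_mkcond [X in _ * X]big_mkcond.
rewrite -big_split; apply: eq_bigr => a _; rewrite inE.
by do 2!case: (_ \in _); case: (P a); rewrite /= ?mul1r ?mulr1 ?F2.
Qed.

Lemma cl_signN1 (I : Type) (r : seq I) (P : pred I) :
  (\prod_(i <- r | P i) (-1 : R)) * \prod_(i <- r | P i) -1 = 1.
Proof. by rewrite -big_split big1 // => i _; rewrite /= mulrNN mulr1. Qed.

Lemma cl_signDl A B C : cl_sign (symd A B) C = cl_sign A C * cl_sign B C.
Proof.
have E (D : {set 'I_m.-1}) (F : 'I_m.-1 -> R) :
  \prod_(a in D) F a = \prod_(a in D | xpredT a) F a.
  by apply: eq_bigl => a; rewrite andbT.
by rewrite /cl_sign !E cl_prod_symd // => a; exact: cl_signN1.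
Qed.

Lemma cl_signDr A B C : cl_sign A (symd B C) = cl_sign A B * cl_sign A C.
Proof.
rewrite /cl_sign -big_split; apply: eq_bigr => a _.
by rewrite cl_prod_symd // => b; rewrite mulrNN mulr1.
Qed.

Lemma cl_sign0l A : cl_sign finset.set0 A = 1.
Proof. by rewrite /cl_sign big_set0. Qed.

Lemma cl_sign0r A : cl_sign A finset.set0 = 1.
Proof.
rewrite /cl_sign big1 // => a _; rewrite big_pred0 // => b.
by rewrite inE.
Qed.

Lemma cl_sign_sqr A B : cl_sign A B * cl_sign A B = 1.
Proof. by rewrite -cl_signDl symdd cl_sign0l. Qed.

Lemma cl_mulA : associative cl_mul.
Proof.
move=> x y z; apply/ffunP => D; rewrite !ffunE; symmetry.
under eq_bigr => C _ do rewrite ffunE mulr_suml mulr_sumr.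
rewrite exchange_big /=; apply: eq_bigr => A _.
rewrite ffunE !mulr_sumr.
rewrite [RHS](reindex_inj (@symd_inj _ A)) /=; apply: eq_bigr => C _.
rewrite (_ : symd (symd A C) (symd A D) = symd C D); last first.
  by rewrite -symdA [symd C _]symdC symdA symdA symdd sym0d symdC.
rewrite (_ : symd A D = symd (symd A C) (symd C D)); last first.
  by rewrite -symdA symdK.
rewrite [cl_sign A (symd (symd A C) _)]cl_signDr.
rewrite [cl_sign (symd A C) _]cl_signDl.
have /esym s2 := cl_sign_sqr A (symd C D).
rewrite -[LHS]mul1r s2; ring.
Qed.

Lemma cl_mul1x : left_id cl_one cl_mul.
Proof.
move=> x; apply/ffunP => C; rewrite ffunE (bigD1 finset.set0) //= ffunE eqxx.
rewrite sym0d cl_sign0l !mul1r big1 ?addr0 // => A /negPf A0.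
by rewrite ffunE A0 mul0r mulr0.
Qed.

Lemma cl_mulx1 : right_id cl_one cl_mul.
Proof.
move=> x; apply/ffunP => C; rewrite ffunE (bigD1 C) //= ffunE symdd eqxx.
rewrite cl_sign0r mul1r mulr1 big1 ?addr0 // => A /negPf AC.
by rewrite ffunE symd_eq0 AC !mulr0.
Qed.

Lemma cl_mulDl : left_distributive cl_mul +%R.
Proof.
move=> x y z; apply/ffunP => C; rewrite !ffunE -big_split.
by apply: eq_bigr => A _; rewrite ffunE /= mulrDl mulrDr.
Qed.

Lemma cl_mulDr : right_distributive cl_mul +%R.
Proof.
move=> x y z; apply/ffunP => C; rewrite !ffunE -big_split.
by apply: eq_bigr => A _; rewrite ffunE /= !mulrDr.
Qed.

Lemma cl_one_neq0 : cl_one != 0.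
Proof.
apply/eqP => /ffunP /(_ finset.set0); rewrite !ffunE eqxx.
exact/eqP/oner_neq0.
Qed.

HB.instance Definition _ := GRing.Zmodule_isNzRing.Build (clifford R m)
  cl_mulA cl_mul1x cl_mulx1 cl_mulDl cl_mulDr cl_one_neq0.

Lemma cl_scaleAl (k : R) x y : k *: (x * y) = (k *: x) * y.
Proof.
apply/ffunP => C; rewrite !ffunE /GRing.scale /= mulr_sumr.
by apply: eq_bigr => A _; rewrite ffunE /GRing.scale /=; ring.
Qed.

HB.instance Definition _ :=
  GRing.Lmodule_isLalgebra.Build R (clifford R m) cl_scaleAl.

Lemma cl_scaleAr (k : R) x y : k *: (x * y) = x * (k *: y).
Proof.
apply/ffunP => C; rewrite !ffunE /GRing.scale /= mulr_sumr.
by apply: eq_bigr => A _; rewrite ffunE /GRing.scale /=; ring.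
Qed.

HB.instance Definition _ :=
  GRing.Lalgebra_isAlgebra.Build R (clifford R m) cl_scaleAr.

Definition cl_unit : pred (clifford R m) :=
  fun x => `[< exists y, y * x = 1 /\ x * y = 1 >].

Definition cl_inv x : clifford R m :=
  if pselect (exists y, y * x = 1 /\ x * y = 1) is left e
  then projT1 (cid e) else x.

Lemma cl_mulVx : {in cl_unit, left_inverse 1 cl_inv *%R}.
Proof.
by move=> x /asboolP xu; rewrite /cl_inv; case: pselect => // e; case: cid => y [].
Qed.

Lemma cl_mulxV : {in cl_unit, right_inverse 1 cl_inv *%R}.
Proof.
by move=> x /asboolP xu; rewrite /cl_inv; case: pselect => // e; case: cid => y [].
Qed.

Lemma cl_unitP x y : y * x = 1 /\ x * y = 1 -> cl_unit x.
Proof. by move=> xy; apply/asboolP; exists y. Qed.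

Lemma cl_inv_out : {in [predC cl_unit], cl_inv =1 id}.
Proof.
move=> x /negP; rewrite /cl_inv; case: pselect => // e; case.
exact/asboolP.
Qed.

HB.instance Definition _ := GRing.NzRing_hasMulInverse.Build (clifford R m)
  cl_mulVx cl_mulxV cl_unitP cl_inv_out.

End CliffordRing.

Section CliffordBasics.
Variables (R : realType) (m : nat).
Implicit Types (A B C : {set 'I_m.-1}) (x y : clifford R m).

(* The set {i_j}, for j < m; it is empty for j = 0, so that i_0 = 1.
   It is also empty for j >= m, which is never used. *)
Definition cl_index (j : nat) : {set 'I_m.-1} := [set a : 'I_m.-1 | a.+1 == j]%SET.

Definition cl_i (j : nat) : clifford R m := [ffun A => (A == cl_index j)%:R].

Definition cl_coord x (j : nat) : R := x (cl_index j).

(* The involution x': i_A has #|A| factors. *)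
Definition cl_main x : clifford R m := [ffun A : {set 'I_m.-1} => (\prod_(a in A) -1) * x A].

(* The involution x^*: reversing the product i_A transposes every pair
   b < a of elements of A. *)
Definition cl_star x : clifford R m :=
  [ffun A : {set 'I_m.-1} => (\prod_(a in A) \prod_(b in A | (b < a)%N) -1) * x A].

Definition cl_bar x : clifford R m := cl_star (cl_main x).

(* On V_m this is the Euclidean norm; by [cl_bar_norm] its square is the
   coordinate of x * cl_bar x on 1, hence it is x * cl_bar x itself when the
   latter is a scalar, as for x in the Clifford group. *)
Definition cl_norm x : R := Num.sqrt (\sum_A x A ^+ 2).

(* V_p inside C_m, for p <= m. *)
Definition cl_vec (p : nat) : set (clifford R m) :=
  [set x | exists c : nat -> R, x = \sum_(0 <= j < p) c j *: cl_i j].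

(* Gamma_p inside C_m, for p <= m. *)
Inductive cl_group (p : nat) : clifford R m -> Prop :=
| cl_group_vec v : cl_vec p v -> v != 0 -> cl_group p v
| cl_group1 : cl_group p 1
| cl_groupM x y : cl_group p x -> cl_group p y -> cl_group p (x * y)
| cl_groupV x : cl_group p x -> cl_group p x^-1.

Definition cl_group0 (p : nat) : set (clifford R m) :=
  [set x | cl_group p x \/ x = 0].

Lemma cl_i0 : cl_i 0 = 1.
Proof.
apply/ffunP => A; rewrite !ffunE (_ : cl_index 0 = finset.set0) //.
Qed.

Lemma cl_basisM A B (x y : clifford R m) :
    x = [ffun C => (C == A)%:R] -> y = [ffun C => (C == B)%:R] ->
  x * y = cl_sign R A B *: ([ffun C => (C == symd A B)%:R] : clifford R m).
Proof.
move=> -> ->; apply/ffunP => C; rewrite !ffunE (bigD1 A) //= !ffunE eqxx mul1r.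
rewrite big1 ?addr0 => [|D /negPf DA]; last by rewrite ffunE DA mul0r mulr0.
rewrite (_ : (symd A C == B) = (C == symd A B)); last first.
  by rewrite -(inj_eq (@symd_inj _ A)) symdK.
rewrite /GRing.scale /=; case: eqP => [->|_]; last by rewrite !mulr0.
by rewrite symdK.
Qed.

Lemma cl_index1 (j : nat) (jm : (j < m.-1)%N) :
  cl_index j.+1 = [set Ordinal jm]%SET.
Proof. by apply/setP => a; rewrite !inE eqSS -val_eqE. Qed.

Lemma cl_iE (j : nat) (jm : (j < m.-1)%N) :
  cl_i j.+1 = [ffun C => (C == [set Ordinal jm]%SET)%:R].
Proof. by rewrite /cl_i cl_index1. Qed.

Lemma cl_sign1 (a b : 'I_m.-1) : cl_sign R [set a]%SET [set b]%SET = (-1) ^+ (b <= a)%N.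
Proof.
rewrite /cl_sign big_set1 big_mkcondr /= big_set1.
by case: leqP; rewrite ?expr1 ?expr0.
Qed.

Lemma cl_i_sqr (j : nat) : (0 < j < m)%N -> cl_i j * cl_i j = -1.
Proof.
case: j => // j jm.
have jm1 : (j < m.-1)%N by case: m jm.
rewrite (cl_basisM (cl_iE jm1) (cl_iE jm1)) symdd cl_sign1 leqnn expr1 scaleN1r.
by congr (- _); apply/ffunP => A; rewrite !ffunE.
Qed.

Lemma cl_i_anticomm (j k : nat) :
  (0 < j < m)%N -> (0 < k < m)%N -> j != k ->
  cl_i j * cl_i k = - (cl_i k * cl_i j).
Proof.
case: j k => // j [] // k jm km jk.
have jm1 : (j < m.-1)%N by case: m jm.
have km1 : (k < m.-1)%N by case: m km.
rewrite (cl_basisM (cl_iE jm1) (cl_iE km1)) (cl_basisM (cl_iE km1) (cl_iE jm1)).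
rewrite symdC !cl_sign1 /= -scaleNr; congr (_ *: _).
rewrite eqSS in jk.
by case: ltngtP jk; rewrite // ?expr1 ?expr0 ?opprK.
Qed.

Lemma cl_rev_sign A :
  \prod_(a in A) \prod_(b in A | (b < a)%N) -1 =
  (\prod_(a in A) -1) * cl_sign R A A.
Proof.
rewrite /cl_sign -big_split; apply: eq_bigr => a aA /=.
rewrite [in RHS](bigD1 a) /= ?aA ?leqnn // mulN1r mulN1r opprK.
apply: eq_bigl => b; rewrite ltn_neqAle -val_eqE /=.
by rewrite -!andbA; congr (_ && _); rewrite andbC.
Qed.

Lemma cl_starM x y : cl_star (x * y) = cl_star y * cl_star x.
Proof.
apply/ffunP => C; rewrite !ffunE mulr_sumr.
rewrite [RHS](reindex_inj (@symd_inj _ C)) /=; apply: eq_bigr => A _.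
have -> : symd (symd C A) C = A by rewrite symdC symdK.
rewrite !ffunE !cl_rev_sign [symd A C]symdC.
have [B BE] : exists B, B = symd C A by exists (symd C A).
have CE : C = symd A B by rewrite BE symdC -symdA symdd symd0.
rewrite -BE CE {BE CE}.
have E : \prod_(a in symd A B) (-1 : R) =
         (\prod_(a in A) -1) * \prod_(a in B) -1.
  have F (D : {set 'I_m.-1}) :
    \prod_(a in D) (-1 : R) = \prod_(a in D | xpredT a) -1.
    by apply: eq_bigl => a; rewrite andbT.
  by rewrite !F cl_prod_symd // => a; rewrite mulrNN mulr1.
rewrite E cl_signDl !cl_signDr.
have := cl_sign_sqr R A B.
set s := cl_sign R A B => s2.
transitivity (s * s * ((\prod_(a in A) -1) * (\prod_(a in B) -1)
  * cl_sign R A A * cl_sign R B B * cl_sign R B A * x A * y B)).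
  ring.
rewrite s2; ring.
Qed.

Lemma cl_star_i (j : nat) : cl_star (cl_i j) = cl_i j.
Proof.
apply/ffunP => A; rewrite !ffunE.
case: eqP => [->|_]; last by rewrite mulr0.
rewrite mulr1 big1 // => a; rewrite inE => /eqP aj.
rewrite big_pred0 // => b; rewrite inE -aj eqSS.
by case: ltngtP; rewrite ?andbF.
Qed.

Lemma cl_main_i (j : nat) : (0 < j < m)%N -> cl_main (cl_i j) = - cl_i j.
Proof.
case: j => // j jm.
have jm1 : (j < m.-1)%N by case: m jm.
rewrite (cl_iE jm1); apply/ffunP => A; rewrite !ffunE.
by case: eqP => [->|_]; rewrite ?big_set1 ?mulN1r // mulr0 oppr0.
Qed.

Lemma cl_bar_norm x : (x * cl_bar x) finset.set0 = cl_norm x ^+ 2.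
Proof.
rewrite /cl_norm sqr_sqrtr; last by apply: sumr_ge0 => A _; exact: sqr_ge0.
rewrite ffunE; apply: eq_bigr => A _; rewrite symd0 !ffunE cl_rev_sign.
have e2 : (\prod_(a in A) (-1 : R)) * \prod_(a in A) -1 = 1.
  exact: cl_signN1.
transitivity ((\prod_(a in A) (-1 : R)) * (\prod_(a in A) -1)
  * (cl_sign R A A * cl_sign R A A) * x A ^+ 2); first ring.
by rewrite e2 cl_sign_sqr !mul1r.
Qed.

End CliffordBasics.

Definition squarefree (k : nat) : Prop :=
  forall q : nat, (q ^ 2 %| k)%N -> q = 1%N.

Section CliffordOrders.
Variables (R : realType) (n : nat).

(* All of C_n, V_n, V_{n+1}, Gamma_n, K and O live inside C_{n+1}. *)
Local Notation C := (clifford R n.+1).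
Implicit Types (O : set C) (g h : 'M[C]_2).

(* The form d_1 y_1^2 + ... + d_{n-1} y_{n-1}^2 is primitive; for n = 1
   (K = Q) there is no variable and no condition. *)
Definition primitive_form (d : nat -> nat) : Prop :=
  (1 < n)%N -> (\big[gcdn/0]_(1 <= j < n) d j)%N = 1%N.

(* K = Q[sqrt(d_1) i_1, ..., sqrt(d_{n-1}) i_{n-1}], the Q-subalgebra
   generated by these elements. *)
Inductive cl_rat (d : nat -> nat) : C -> Prop :=
| cl_rat_cst (q : rat) : cl_rat d (ratr q)%:A
| cl_rat_gen j : (0 < j < n)%N ->
    cl_rat d (Num.sqrt (d j)%:R *: cl_i R n.+1 j)
| cl_ratD x y : cl_rat d x -> cl_rat d y -> cl_rat d (x + y)
| cl_ratM x y : cl_rat d x -> cl_rat d y -> cl_rat d (x * y).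

Definition full_lattice (K O : set C) : Prop :=
  exists (N : nat) (b : 'I_N -> C),
    (forall x, O x <-> exists z : 'I_N -> int, x = \sum_i b i *~ z i) /\
    (forall x, K x <-> exists q : 'I_N -> rat, x = \sum_i ratr (q i) *: b i).

Record is_order (K O : set C) : Prop := IsOrder {
  order_sub : O `<=` K;
  order1 : O 1;
  orderB : forall x y, O x -> O y -> O (x - y);
  orderM : forall x y, O x -> O y -> O (x * y);
  order_lattice : full_lattice K O }.

Definition star_closed O : Prop := forall x, O x -> O (cl_star x).

Definition order_group O : set C := O `&` cl_group0 n.

Definition order_vec O : set C := O `&` cl_vec n.

(* The quotient c^-1 d ranges over the invertible elements of
   Vec(K) = K `&` V_n, as it does for the bottom rows (c, d) of elements of
   SL_2(O).  Over all invertible elements of K the condition would fail for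
   every order once n >= 3: O contains some d = k i_1 i_2 with |d| >= 1, and
   |d - a| >= |d| for every vector a.  That variant is a stronger assumption
   on O, cf. [clifford_euclideanW]. *)
Definition clifford_euclidean (K O : set C) : Prop :=
  forall c d : C, order_group O c -> order_group O d ->
    (K `&` cl_vec n) (c^-1 * d) -> c^-1 * d \is a GRing.unit ->
  exists a r : C,
    [/\ order_vec O a, d = c * a + r & cl_norm r < cl_norm c].

Lemma clifford_euclideanW (K O : set C) :
    (forall c d : C, order_group O c -> order_group O d ->
       K (c^-1 * d) -> c^-1 * d \is a GRing.unit ->
     exists a r : C,
       [/\ order_vec O a, d = c * a + r & cl_norm r < cl_norm c]) ->
  clifford_euclidean K O.
Proof. by move=> H c d Oc Od [Kcd _]; exact: H. Qed.

Record in_SL2 g : Prop := InSL2 {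
  SL2_entries : forall i j, cl_group0 n (g i j);
  SL2_det : g 0 0 * cl_star (g 1 1) - g 0 1 * cl_star (g 1 0) = 1;
  SL2_ab : cl_vec n (g 0 0 * cl_star (g 0 1));
  SL2_cd : cl_vec n (g 1 0 * cl_star (g 1 1));
  SL2_ca : cl_vec n (cl_star (g 1 0) * g 0 0);
  SL2_db : cl_vec n (cl_star (g 1 1) * g 0 1) }.

Definition in_SL2_order O g : Prop :=
  [/\ in_SL2 g, forall i j, O (g i j) &
      exists h, [/\ g *m h = 1%:M, h *m g = 1%:M & forall i j, O (h i j)]].

Definition mobius g (x : C) : C :=
  (g 0 0 * x + g 0 1) * (g 1 0 * x + g 1 1)^-1.

Definition S_infty : set C := [set x | cl_vec n.+1 x /\ cl_coord x n = 1].

(* An element of PSL_2(O) = SL_2(O)/{1, -1} acts through either of its two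
   representatives g, -g in SL_2(O). *)
Definition ford_spheres O : set (set C) :=
  [set S | exists2 g, in_SL2_order O g & S = mobius g @` S_infty].

Definition tangent (S T : set C) : Prop := S <> T /\ S `&` T !=set0.

End CliffordOrders.

Definition connected_graph (T : Type) (V : set T) (adj : T -> T -> Prop) :=
  forall s t : T, V s -> V t ->
  clos_refl_trans T (fun x y => [/\ V x, V y & adj x y]) s t.

(* Main.v *)
(* Let J be the inversion with rows (0, -1), (1, 0) and T_v the translation by
   a vector v of O.  The sphere g T_v(S_infty) equals g(S_infty), and
   g J(S_infty) meets g(S_infty) at g(i_n).  If g has bottom row (c, e) and
   e = c a + r, then g T_(-a) J has bottom row (r, -c) and |r| < |c|: iterating
   is the Euclidean algorithm.  It stops because the squared norms of the
   elements of O lie in a lattice of R.  It ends with c = 0, where g is an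
   isometry x |-> a x a^* + b a^* with |a| = 1, again by discreteness of norms,
   and therefore fixes S_infty.  Two consecutive spheres may coincide, which is
   harmless for connectedness. *)
From HB Require Import structures.
Require Import Defs.
From Stdlib Require Import Relation_Operators.
From mathcomp Require Import all_boot all_order all_algebra.
From mathcomp Require Import boolp classical_sets reals ring.

Set Implicit Arguments.
Unset Strict Implicit.
Unset Printing Implicit Defensive.

Import Order.TTheory GRing.Theory Num.Theory.

Local Open Scope ring_scope.
Local Open Scope classical_set_scope.

(** * The three involutions and the norm *)

Section Involutions.
Variables (R : realType) (m : nat).
Local Notation C := (clifford R m).
Implicit Types (x y z : C) (k : R).

Lemma cl_main_linear : linear (@cl_main R m).
Proof.
by move=> k x y; apply/ffunP => A; rewrite !ffunE /GRing.scale /=; ring.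
Qed.

HB.instance Definition _ :=
  GRing.isLinear.Build R C C _ (@cl_main R m) cl_main_linear.

Lemma cl_star_linear : linear (@cl_star R m).
Proof.
by move=> k x y; apply/ffunP => A; rewrite !ffunE /GRing.scale /=; ring.
Qed.

HB.instance Definition _ :=
  GRing.isLinear.Build R C C _ (@cl_star R m) cl_star_linear.

Lemma cl_bar_linear : linear (@cl_bar R m).
Proof. by move=> k x y; rewrite /cl_bar !linearP. Qed.

HB.instance Definition _ :=
  GRing.isLinear.Build R C C _ (@cl_bar R m) cl_bar_linear.

(** The sign (-1)^|A| is multiplicative for the symmetric difference, and B is the symmetric
    difference of A and [symd A B]. *)
Lemma cl_mainM x y : cl_main (x * y) = cl_main x * cl_main y.
Proof.
apply/ffunP => B; rewrite !ffunE mulr_sumr; apply: eq_bigr => A _.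
rewrite !ffunE.
have -> : \prod_(a in B) (-1 : R) =
    (\prod_(a in A) -1) * \prod_(a in symd A B) -1.
  have E (D : {set 'I_m.-1}) :
    \prod_(a in D) (-1 : R) = \prod_(a in D | xpredT a) -1.
    by apply: eq_bigl => a; rewrite andbT.
  rewrite -{1}(symdK A B) !E.
  by rewrite cl_prod_symd // => a; rewrite mulrNN mulr1.
ring.
Qed.

Lemma cl_mainK : involutive (@cl_main R m).
Proof. by move=> x; apply/ffunP => A; rewrite !ffunE mulrA cl_signN1 mul1r. Qed.

Lemma cl_starK : involutive (@cl_star R m).
Proof.
move=> x; apply/ffunP => A; rewrite !ffunE mulrA -big_split /= big1 ?mul1r //.
by move=> a _; rewrite cl_signN1.
Qed.

Lemma cl_star_main x : cl_star (cl_main x) = cl_main (cl_star x).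
Proof. by apply/ffunP => A; rewrite !ffunE mulrCA. Qed.

Lemma cl_barK : involutive (@cl_bar R m).
Proof. by move=> x; rewrite /cl_bar cl_star_main cl_starK cl_mainK. Qed.

Lemma cl_barM x y : cl_bar (x * y) = cl_bar y * cl_bar x.
Proof. by rewrite /cl_bar cl_mainM cl_starM. Qed.

Lemma cl_star1 : cl_star (1 : C) = 1.
Proof. by rewrite -cl_i0 cl_star_i. Qed.

(** A multiplicative involution f fixes 1: [f 1 = f (f 1) * f 1 = f (f 1 * 1) = 1]. *)
Lemma cl_main1 : cl_main (1 : C) = 1.
Proof. by rewrite -[LHS]mul1r -{1}(cl_mainK 1) -cl_mainM mulr1 cl_mainK. Qed.

Lemma cl_bar1 : cl_bar (1 : C) = 1.
Proof. by rewrite /cl_bar cl_main1 cl_star1. Qed.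

Lemma cl_norm_ge0 x : 0 <= cl_norm x.
Proof. exact: sqrtr_ge0. Qed.

Lemma cl_norm_sqr x : cl_norm x ^+ 2 = \sum_A x A ^+ 2.
Proof. by rewrite sqr_sqrtr //; apply: sumr_ge0 => A _; exact: sqr_ge0. Qed.

Lemma cl_norm_gt0 x : (0 < cl_norm x) = (x != 0).
Proof.
rewrite lt_def cl_norm_ge0 andbT -sqrf_eq0 cl_norm_sqr.
rewrite psumr_eq0 => [|A _]; last exact: sqr_ge0.
congr (~~ _); apply/allP/eqP => [x0|-> A _]; last by rewrite ffunE expr0n eqxx.
apply/ffunP => A; rewrite ffunE; apply/eqP; rewrite -sqrf_eq0.
by apply: x0; rewrite mem_index_enum.
Qed.

(** The norm is defined by coordinates; comparing coordinates on 1 recovers the algebraic norm as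
    soon as [x * cl_bar x] is known to be a scalar. *)
Lemma cl_norm_scalar x k : x * cl_bar x = k%:A -> cl_norm x ^+ 2 = k.
Proof.
by move=> xk; rewrite -cl_bar_norm xk !ffunE eqxx /GRing.scale /= mulr1.
Qed.

End Involutions.

(** * Clifford vectors and their inner product *)

Section Vectors.
Variables (R : realType) (m p : nat).
Local Notation C := (clifford R m).
Local Notation V := (@cl_vec R m p).
Implicit Types (u v w : C) (k : R).

(** Properties stable under linear combinations need checking only on 1 and the generators;
    identities linear in a vector are proved this way. *)
Lemma cl_vec_ind (P : C -> Prop) :
    (forall k u v, P u -> P v -> P (k *: u + v)) -> P 0 ->
    (forall j, (j < p)%N -> P (cl_i R m j)) ->
  forall v, V v -> P v.
Proof.
move=> PL P0 Pi v [c ->]; rewrite big_seq.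
elim/big_rec: _ => // j x; rewrite mem_index_iota => /andP[_ jp].
by apply: PL; apply: Pi.
Qed.

Lemma cl_vecP k u v : V u -> V v -> V (k *: u + v).
Proof.
move=> [c ->] [e ->]; exists (fun j => k * c j + e j).
rewrite scaler_sumr -big_split; apply: eq_bigr => j _ /=.
by rewrite scalerDl scalerA.
Qed.

Lemma cl_vec0 : V 0.
Proof. by exists (fun=> 0); rewrite big1 // => j _; rewrite scale0r. Qed.

Lemma cl_vecD u v : V u -> V v -> V (u + v).
Proof. by rewrite -{2}(scale1r u); exact: cl_vecP. Qed.

Lemma cl_vecZ k u : V u -> V (k *: u).
Proof. by move=> Vu; rewrite -(addr0 (k *: u)); apply: cl_vecP cl_vec0. Qed.

Lemma cl_vecN u : V u -> V (- u).
Proof. by rewrite -scaleN1r; exact: cl_vecZ. Qed.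

Lemma cl_vecB u v : V u -> V v -> V (u - v).
Proof. by move=> Vu Vv; apply: cl_vecD => //; exact: cl_vecN. Qed.

Lemma cl_vec_i j : (j < p)%N -> V (cl_i R m j).
Proof.
move=> jp; exists (fun l => (l == j)%:R).
rewrite big_mkord (bigD1 (Ordinal jp)) //= eqxx scale1r big1 ?addr0 // => l.
by rewrite -val_eqE /= => /negPf ->; rewrite scale0r.
Qed.

Lemma cl_vec1 : (0 < p)%N -> V 1.
Proof. by rewrite -cl_i0; exact: cl_vec_i. Qed.

Lemma cl_vec_star v : V v -> cl_star v = v.
Proof.
move: v; apply: cl_vec_ind => [k u v uE vE||j _]; last exact: cl_star_i.
  by rewrite linearP /= uE vE.
exact: linear0.
Qed.

Lemma cl_vec_bar_main v : V v -> cl_bar v = cl_main v.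
Proof. by move=> Vv; rewrite /cl_bar cl_star_main (cl_vec_star Vv). Qed.

Hypothesis pm : (p <= m)%N.

Lemma cl_main_i_sign j : (j < m)%N ->
  cl_main (cl_i R m j) = (if j == 0%N then 1 else -1 : R) *: cl_i R m j.
Proof.
case: j => [|j] jm; first by rewrite scale1r cl_i0 cl_main1.
by rewrite cl_main_i // scaleN1r.
Qed.

Lemma cl_vec_main v : V v -> V (cl_main v).
Proof.
move: v; apply: cl_vec_ind => [k u v||j jp].
- by rewrite linearP; exact: cl_vecP.
- by rewrite linear0; exact: cl_vec0.
rewrite cl_main_i_sign; last exact: leq_trans pm.
exact/cl_vecZ/cl_vec_i.
Qed.

Lemma cl_vec_bar v : V v -> V (cl_bar v).
Proof. by move=> Vv; rewrite cl_vec_bar_main //; exact: cl_vec_main. Qed.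

(** The scalar is 2 for i = j. Otherwise the two terms cancel: by anticommutation if i, j > 0, and
    if one index is 0 because conjugation fixes 1 and negates the other generator. *)
Lemma cl_i_dot i j : (i < p)%N -> (j < p)%N -> exists k : R,
  cl_i R m i * cl_bar (cl_i R m j) + cl_i R m j * cl_bar (cl_i R m i) = k%:A.
Proof.
move=> ip jp; have im := leq_trans ip pm; have jm := leq_trans jp pm.
rewrite !cl_vec_bar_main; try exact: cl_vec_i.
rewrite !cl_main_i_sign // -!scalerAr.
have [<-|ij] := eqVneq i j.
  case: (posnP i) => [->|i0].
    by exists 2; rewrite cl_i0 mulr1 scale1r scaler_nat.
  exists 2; rewrite cl_i_sqr ?i0 // scaleN1r opprK.
  by rewrite scaler_nat.
exists 0; rewrite scale0r.
case: i j ip jp im jm ij => [|i] [|j] // ip jp im jm ij.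
- by rewrite cl_i0 /= mulr1 mul1r scaleN1r scale1r addNr.
- by rewrite cl_i0 /= mulr1 mul1r scaleN1r scale1r addrN.
by rewrite /= (cl_i_anticomm R (m := m)) // scalerN addNr.
Qed.

(** Polar form of the squared norm. The expression is bilinear, so both vectors reduce to
    generators. *)
Lemma cl_vec_dot u v : V u -> V v ->
  exists k : R, u * cl_bar v + v * cl_bar u = k%:A.
Proof.
move=> Vu; move: v; apply: cl_vec_ind => [k v w [r vr] [s ws]||j jp].
- exists (k * r + s); rewrite linearP /= mulrDr mulrDl -scalerAr -scalerAl.
  by rewrite addrACA -scalerDr vr ws scalerA scalerDl.
- by exists 0; rewrite linear0 mulr0 mul0r addr0 scale0r.
move: u Vu; apply: cl_vec_ind => [k v w [r vr] [s ws]||i ip].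
- exists (k * r + s); rewrite linearP /= mulrDr mulrDl -scalerAr -scalerAl.
  by rewrite addrACA -scalerDr vr ws scalerA scalerDl.
- by exists 0; rewrite linear0 mulr0 mul0r addr0 scale0r.
exact: cl_i_dot.
Qed.

Lemma cl_vec_mul_bar v : V v -> v * cl_bar v = (cl_norm v ^+ 2)%:A.
Proof.
move=> Vv; have [k vk] := cl_vec_dot Vv Vv.
have vE : v * cl_bar v = (2^-1 * k)%:A.
  by rewrite -scalerA -vk -mulr2n -scaler_nat scalerA mulVf ?pnatr_eq0 // scale1r.
by rewrite (cl_norm_scalar vE).
Qed.

(** This is the previous identity for the conjugate of v, which has the same norm because
    conjugation only changes signs of coordinates. *)
Lemma cl_bar_mul_vec v : V v -> cl_bar v * v = (cl_norm v ^+ 2)%:A.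
Proof.
move=> Vv; have := cl_vec_mul_bar (cl_vec_bar Vv); rewrite cl_barK => ->.
congr (_%:A); rewrite !cl_norm_sqr; apply: eq_bigr => A _.
rewrite !ffunE !exprMn !expr2 cl_signN1 mul1r -big_split big1 ?mul1r //= => a _.
by rewrite cl_signN1.
Qed.

(* With u the conjugate of v, the dot product gives w v = k - u w^bar, hence
   w v w = k w - |w|^2 u. *)
Lemma cl_vec_sandwich w v : V w -> V v -> V (w * v * w).
Proof.
move=> Vw Vv; have Vu := cl_vec_bar Vv.
have [k] := cl_vec_dot Vw Vu; rewrite cl_barK => /(canRL (addrK _)) ->.
rewrite mulrBl -mulrA cl_bar_mul_vec // -scalerAl mul1r -scalerAr mulr1.
by apply: cl_vecB; apply: cl_vecZ.
Qed.

End Vectors.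

(** * The Clifford group: inverses, norms and its action on vectors *)

Section CliffordGroup.
Variables (R : realType) (m p : nat).
Hypothesis pm : (p <= m)%N.
Local Notation C := (clifford R m).
Local Notation V := (@cl_vec R m p).
Local Notation G := (@cl_group R m p).
Implicit Types (x y u v w : C) (k : R).

Lemma cl_invE x k : k != 0 -> x * cl_bar x = k%:A -> cl_bar x * x = k%:A ->
  x \is a GRing.unit /\ x^-1 = k^-1 *: cl_bar x.
Proof.
move=> k0 xk kx.
have xV : x * (k^-1 *: cl_bar x) = 1.
  by rewrite -scalerAr xk scalerA mulVf // scale1r.
have Vx : (k^-1 *: cl_bar x) * x = 1.
  by rewrite -scalerAl kx scalerA mulVf // scale1r.
have xu : x \is a GRing.unit by apply/unitrP; exists (k^-1 *: cl_bar x).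
by split => //; rewrite -[LHS]mulr1 -xV mulKr.
Qed.

(** Induction on the construction of x: scalars are central, so those of two factors multiply, and
    an inverse is the conjugate divided by the scalar. *)
Lemma cl_group_bar x : G x -> exists k, [/\ 0 < k, x * cl_bar x = k%:A
  & cl_bar x * x = k%:A].
Proof.
elim=> [v Vv v0||{}x y _ [k [k0 xk kx]] _ [l [l0 yl ly]]|{}x _ [k [k0 xk kx]]].
- exists (cl_norm v ^+ 2); split; last exact: (cl_bar_mul_vec pm).
    by rewrite exprn_gt0 // cl_norm_gt0.
  exact: (cl_vec_mul_bar pm).
- by exists 1; rewrite cl_bar1 mulr1 scale1r.
- exists (k * l); rewrite mulr_gt0 // cl_barM; split => //.
    rewrite mulrA -(mulrA x) yl -scalerAr mulr1 -scalerAl xk scalerA.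
    by rewrite mulrC.
  by rewrite mulrA -(mulrA (cl_bar y)) kx -scalerAr mulr1 -scalerAl ly scalerA.
have [_ ->] := cl_invE (lt0r_neq0 k0) xk kx.
exists k^-1; rewrite invr_gt0 k0 linearZ /= cl_barK.
rewrite -!scalerAl -!scalerAr xk kx !scalerA mulrC.
by rewrite mulrCA mulfV ?lt0r_neq0 // mulr1.
Qed.

Lemma cl_group_norm x : G x -> [/\ 0 < cl_norm x,
  x * cl_bar x = (cl_norm x ^+ 2)%:A & cl_bar x * x = (cl_norm x ^+ 2)%:A].
Proof.
move=> /cl_group_bar[k [k0 xk kx]]; rewrite (cl_norm_scalar xk); split => //.
by rewrite -(@ltr_pXn2r _ 2) ?nnegrE ?cl_norm_ge0 // (cl_norm_scalar xk) expr0n.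
Qed.

Lemma cl_group_unit x : G x -> x \is a GRing.unit.
Proof.
by move=> /cl_group_bar[k [/lt0r_neq0 k0 xk kx]]; case: (cl_invE k0 xk kx).
Qed.

Lemma cl_group_inv x : G x -> x^-1 = (cl_norm x ^+ 2)^-1 *: cl_bar x.
Proof.
move=> /cl_group_norm[x0 xk kx].
by case: (cl_invE _ xk kx) => //; rewrite expf_neq0 // lt0r_neq0.
Qed.

Lemma cl_group_normM x y : G x -> G y -> cl_norm (x * y) = cl_norm x * cl_norm y.
Proof.
move=> Gx Gy; have [x0 xk _] := cl_group_norm Gx.
have [y0 yk _] := cl_group_norm Gy.
have [xy0 _ _] := cl_group_norm (cl_groupM Gx Gy).
apply: (@pexpIrn _ 2) => //; rewrite ?nnegrE ?mulr_ge0 ?cl_norm_ge0 //.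
apply: cl_norm_scalar.
rewrite cl_barM mulrA -(mulrA x) yk -scalerAr mulr1 -scalerAl xk scalerA.
by rewrite exprMn mulrC.
Qed.

Lemma cl_star_unitV x : x \is a GRing.unit ->
  cl_star x \is a GRing.unit /\ cl_star x^-1 = (cl_star x)^-1.
Proof.
move=> xu; have xV : cl_star x * cl_star x^-1 = 1.
  by rewrite -cl_starM mulVr // cl_star1.
have Vx : cl_star x^-1 * cl_star x = 1 by rewrite -cl_starM mulrV // cl_star1.
have su : cl_star x \is a GRing.unit by apply/unitrP; exists (cl_star x^-1).
by split => //; rewrite -[RHS]mulr1 -xV mulKr.
Qed.

Lemma cl_group_conj2 x : G x -> forall v, V v ->
  V (x * v * cl_star x) /\ V (cl_star x * v * x).
Proof.
elim=> [w Vw _||{}x y _ IHx _ IHy|{}x Gx IH] v Vv.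
- by rewrite (cl_vec_star Vw); split; apply: (cl_vec_sandwich pm).
- by rewrite cl_star1 !mulr1 mul1r.
- rewrite cl_starM !mulrA; split.
    rewrite -2!(mulrA x).
    by case: (IHx (y * v * cl_star y)) => //; case: (IHy v).
  rewrite -2!(mulrA (cl_star y)).
  by case: (IHy (cl_star x * v * x)) => //; case: (IHx v).
rewrite cl_group_inv // linearZ /= -!scalerAl -!scalerAr.
have {IH}[V1 V2] := IH _ (cl_vec_main pm Vv).
split; do 2!apply: cl_vecZ.
- have -> : cl_bar x * v * cl_star (cl_bar x) =
            cl_main (cl_star x * cl_main v * x).
    by rewrite !cl_mainM cl_mainK /cl_bar cl_starK cl_star_main.
  exact: (cl_vec_main pm).
- have -> : cl_star (cl_bar x) * v * cl_bar x =
            cl_main (x * cl_main v * cl_star x).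
    by rewrite !cl_mainM cl_mainK /cl_bar cl_starK cl_star_main.
  exact: (cl_vec_main pm).
Qed.

Lemma cl_group_conj x v : G x -> V v -> V (x * v * cl_star x).
Proof. by move=> Gx Vv; case: (cl_group_conj2 Gx Vv). Qed.

(** A vector is its own reversal, so [x * cl_star y = y * cl_star x]; acting on it by the inverse of
    x leaves [x^-1 * y]. *)
Lemma cl_vec_ratio x y : G x -> V (x * cl_star y) -> V (x^-1 * y).
Proof.
move=> Gx Vxy; have xu := cl_group_unit Gx; have [su sV] := cl_star_unitV xu.
have := cl_group_conj (cl_groupV Gx) Vxy; rewrite -(cl_vec_star Vxy) cl_starM.
by rewrite cl_starK sV !mulrA mulrK.
Qed.

(** Factor [x * v + y = x * (v + x^-1 * y)]; the second factor is a vector, zero or not. *)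
Lemma cl_group_addM x y v : G x -> V (x^-1 * y) -> V v ->
  cl_group0 p (x * v + y).
Proof.
move=> Gx Vxy Vv; have xu := cl_group_unit Gx.
rewrite -{1}(mulVKr xu y) -mulrDr.
have [->|n0] := eqVneq (v + x^-1 * y) 0; first by right; rewrite mulr0.
by left; apply: cl_groupM => //; apply: cl_group_vec => //; apply: cl_vecD.
Qed.

End CliffordGroup.

(** * The generator i_n and the horosphere at height 1 *)

Section LastGenerator.
Variables (R : realType) (n : nat).
Hypothesis n0 : (0 < n)%N.
Local Notation C := (clifford R n.+1).
Local Notation i_n := (cl_i R n.+1 n).
Implicit Types (x v : C).

(** i_n commutes with 1 and anticommutes with i_1, ..., i_{n-1}, which is the sign change made by
    [cl_main]. *)
Lemma cl_vec_commute_i v : cl_vec n v -> v * i_n = i_n * cl_main v.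
Proof.
move: v; apply: cl_vec_ind => [k u v uE vE||[|j] jn].
- by rewrite linearP /= mulrDl mulrDr -scalerAl -scalerAr uE vE.
- by rewrite linear0 mulr0 mul0r.
- by rewrite cl_i0 cl_main1 mul1r mulr1.
rewrite cl_main_i ?(leq_trans jn) // mulrN (cl_i_anticomm R (m := n.+1)) //.
- by rewrite (leq_trans jn).
- by rewrite n0 ltnSn.
- by rewrite ltn_eqF.
Qed.

Lemma cl_group_commute_i x : cl_group n x -> x * i_n = i_n * cl_main x.
Proof.
elim=> [v Vv _||{}x y _ xE _ yE|{}x Gx xE]; first exact: cl_vec_commute_i.
- by rewrite cl_main1 mul1r mulr1.
- by rewrite cl_mainM -mulrA yE !mulrA xE.
have xu := cl_group_unit (leqnSn n) Gx.
apply: (mulrI xu); rewrite mulVKr // mulrA xE -mulrA -cl_mainM mulrV //.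
by rewrite cl_main1 mulr1.
Qed.

(** Reversing [x * i_n = i_n * cl_main x] gives [i_n * cl_star x = cl_bar x * i_n], and
    [x * cl_bar x] is the squared norm. *)
Lemma cl_group_conj_i x : cl_group n x ->
  x * i_n * cl_star x = cl_norm x ^+ 2 *: i_n.
Proof.
move=> Gx; have /(congr1 (@cl_star _ _)) := cl_group_commute_i Gx.
rewrite !cl_starM cl_star_i => E; rewrite -mulrA E mulrA.
have [_ -> _] := cl_group_norm (leqnSn n) Gx.
by rewrite -scalerAl mul1r.
Qed.

Lemma S_inftyP x : @S_infty R n x <-> exists2 v, cl_vec n v & x = v + i_n.
Proof.
(* Distinct generators sit on distinct basis sets, so the coordinate on i_n isolates the coefficient
   [c n]. *)
have indexE j : (j <= n)%N -> (cl_index n.+1 n == cl_index n.+1 j) = (j == n).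
  move=> jn; apply/eqP/eqP => [/setP E|-> //].
  have := E (Ordinal (n:=n) (m:=n.-1) (ltac:(by rewrite prednK))).
  by rewrite !inE /= prednK // eqxx eq_sym => /esym/eqP.
have coordE (c : nat -> R) :
    cl_coord (\sum_(0 <= j < n.+1) c j *: cl_i R n.+1 j) n = c n.
  rewrite /cl_coord sum_ffunE big_nat_recr //= big1_seq => [|j].
    by rewrite add0r !ffunE eqxx /GRing.scale /= mulr1.
  rewrite mem_index_iota => /andP[_ jn]; rewrite !ffunE indexE ?(ltnW jn) //.
  by rewrite ltn_eqF // /GRing.scale /= mulr0.
split=> [[[c ->]]|[v [c vE] ->]].
  rewrite coordE => cn; exists (\sum_(0 <= j < n) c j *: cl_i R n.+1 j).
    by exists c.
  by rewrite big_nat_recr //= cn scale1r.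
have E : v + i_n =
    \sum_(0 <= j < n.+1) (if (j == n)%N then 1 else c j) *: cl_i R n.+1 j.
  rewrite big_nat_recr //= eqxx scale1r vE; congr (_ + _).
  rewrite !big_nat; apply: eq_bigr => j /andP[_ jn].
  by rewrite ltn_eqF.
by split; [exists (fun j => if (j == n)%N then 1 else c j)|rewrite E coordE eqxx].
Qed.

Lemma cl_i_unit : i_n \is a GRing.unit.
Proof.
apply/unitrP; exists (- i_n); rewrite mulrN mulNr (cl_i_sqr R) ?opprK //.
by rewrite n0 /=.
Qed.

End LastGenerator.

(** * Arithmetic of K and discreteness of norms in an order *)

Section RationalCoordinates.
Variables (R : realType) (n : nat) (d : nat -> nat).
Local Notation C := (clifford R n.+1).
Local Notation K := (@cl_rat R n d).
Implicit Types (x y : C) (A B : {set 'I_n}).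

Lemma cl_rat_star x : K x -> K (cl_star x).
Proof.
elim=> [q|j jn|{}x y _ Kx _ Ky|{}x y _ Kx _ Ky].
- by rewrite linearZ /= cl_star1; exact: cl_rat_cst.
- by rewrite linearZ /= cl_star_i; exact: cl_rat_gen.
- by rewrite linearD; exact: cl_ratD.
- by rewrite cl_starM; exact: cl_ratM.
Qed.

Lemma cl_ratZ (q : rat) x : K x -> K (ratr q *: x).
Proof.
by move=> Kx; rewrite -[x]mul1r scalerAl; apply: cl_ratM => //; exact: cl_rat_cst.
Qed.

Lemma cl_rat_main x : K x -> K (cl_main x).
Proof.
elim=> [q|j jn|{}x y _ Kx _ Ky|{}x y _ Kx _ Ky].
- by rewrite linearZ /= cl_main1; exact: cl_rat_cst.
- rewrite linearZ /= cl_main_i; last first.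
    by case/andP: jn => -> /= /ltnW.
  rewrite scalerN -scaleN1r (_ : -1 = ratr (-1) :> R); last by rewrite rmorphN1.
  exact/cl_ratZ/cl_rat_gen.
- by rewrite linearD; exact: cl_ratD.
- by rewrite cl_mainM; exact: cl_ratM.
Qed.

Lemma cl_rat_bar x : K x -> K (cl_bar x).
Proof. by move=> Kx; apply/cl_rat_star/cl_rat_main. Qed.

(* The square of [sqrt_weight A] is the product of the d_j over the generators
   in A, so K has the elements [sqrt_weight A *: i_A] as a Q-basis. *)
Definition sqrt_weight A : R := Num.sqrt (\prod_(a in A) (d a.+1)%:R).

Lemma weight_ge0 A : 0 <= \prod_(a in A) (d a.+1)%:R :> R.
Proof. by apply: prodr_ge0 => a _; exact: ler0n. Qed.

(** A generator common to A and B contributes d_a twice under the root, and so comes out as an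
    integer factor. *)
Lemma sqrt_weightM A B : sqrt_weight A * sqrt_weight B =
  (\prod_(a in A :&: B) d a.+1)%:R * sqrt_weight (symd A B).
Proof.
rewrite /sqrt_weight -sqrtrM ?weight_ge0 //.
rewrite -[in RHS](@ger0_norm R (\prod_(a in _) _)%:R) ?ler0n //.
rewrite -sqrtr_sqr -sqrtrM ?sqr_ge0 //.
congr Num.sqrt; rewrite natr_prod expr2.
rewrite big_mkcond [X in _ * X]big_mkcond -big_split.
rewrite [X in X * _ * _]big_mkcond [X in _ * X * _]big_mkcond.
rewrite [X in _ * _ * X]big_mkcond -!big_split.
apply: eq_bigr => a _; rewrite !inE.
by case: (_ \in A); case: (_ \in B); rewrite /= ?mulr1 ?mul1r.
Qed.

Definition rational_coords x : Prop :=
  forall A, exists q : rat, x A = ratr q * sqrt_weight A.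

Lemma cl_sign_rat A B : exists q : rat, cl_sign R (m := n.+1) A B = ratr q.
Proof.
exists (\prod_(a in A) \prod_(b in B | (b <= a)%N) -1).
rewrite rmorph_prod; apply: eq_bigr => a _.
by rewrite rmorph_prod; apply: eq_bigr => b _; rewrite rmorphN1.
Qed.

Lemma rational_coordsM x y :
  rational_coords x -> rational_coords y -> rational_coords (x * y).
Proof.
move=> Qx Qy B; rewrite ffunE.
elim/big_ind: _ => [|u v [q ->] [r ->]|A _].
- by exists 0; rewrite rmorph0 mul0r.
- by exists (q + r); rewrite rmorphD mulrDl.
have [q ->] := cl_sign_rat A (symd A B).
have [r ->] := Qx A; have [s ->] := Qy (symd A B).
exists (q * r * s * (\prod_(a in A :&: symd A B) d a.+1)%:R).
rewrite !rmorphM rmorph_nat /= -[RHS]mulrA.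
have := sqrt_weightM A (symd A B); rewrite symdK => <-; ring.
Qed.

Lemma cl_rat_coords x : K x -> rational_coords x.
Proof.
elim=> [q|[//|j] jn|{}x y _ Qx _ Qy|{}x y _ Qx _ Qy]; last exact: rational_coordsM.
- move=> A; exists (q * (A == finset.set0)%:R); rewrite !ffunE rmorphM rmorph_nat.
  rewrite -[LHS]/(ratr q * _) -[RHS]mulrA; congr (ratr q * _).
  case: eqP => [->|]; last by rewrite mul0r.
  by rewrite /sqrt_weight big_set0 sqrtr1 mulr1.
- move=> A; exists (A == cl_index n.+1 j.+1)%:R; rewrite !ffunE rmorph_nat.
  case: eqP => [->|]; last by rewrite /GRing.scale /= mul0r mulr0.
  have jn1 : (j < n.+1.-1)%N by case/andP: jn => _ /ltnW.
  by rewrite cl_index1 /sqrt_weight big_set1 /GRing.scale /= mul1r mulr1.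
- move=> A; have [q xq] := Qx A; have [r yr] := Qy A; exists (q + r).
  by rewrite ffunE xq yr rmorphD mulrDl.
Qed.

Lemma sqrt_weight_sqr A : sqrt_weight A ^+ 2 = (\prod_(a in A) d a.+1)%:R.
Proof. by rewrite sqr_sqrtr ?weight_ge0 // natr_prod. Qed.

Lemma cl_rat_norm x : K x -> exists q : rat, cl_norm x ^+ 2 = ratr q.
Proof.
move=> /cl_rat_coords Qx; rewrite cl_norm_sqr.
elim/big_ind: _ => [|u v [q ->] [r ->]|A _].
- by exists 0; rewrite rmorph0.
- by exists (q + r); rewrite rmorphD.
have [q ->] := Qx A; exists (q ^+ 2 * (\prod_(a in A) d a.+1)%:R).
by rewrite exprMn sqrt_weight_sqr rmorphM rmorphXn rmorph_nat.
Qed.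

(** The inverse is the conjugate divided by the squared norm, and both stay rational over K. *)
Lemma cl_rat_group_inv x : K x -> cl_group n x -> K x^-1.
Proof.
move=> Kx Gx; rewrite (cl_group_inv (leqnSn n) Gx).
have [q ->] := cl_rat_norm Kx.
by rewrite -fmorphV; apply/cl_ratZ/cl_rat_bar.
Qed.

(** A lattice basis is finite, so its rational coordinates have a common denominator D. Then D times
    any coordinate of x is an integer times a weight whose square is an integer, and M = D^2 works.
    Natural values make strong induction on the norm possible. *)
Lemma order_norm_discrete (O : set C) : is_order K O ->
  exists2 M : R, 0 < M &
    forall x, O x -> exists k : nat, M * cl_norm x ^+ 2 = k%:R.
Proof.
move=> ordO; case: (order_lattice ordO) => N [b [bO _]].
have Kb i : K (b i).
  apply: (order_sub ordO); apply/bO; exists (fun j => (j == i)%:R).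
  rewrite (bigD1 i) //= eqxx mulr1z big1 ?addr0 // => j /negPf ->.
  by rewrite mulr0z.
have [q qE] :=
  choice (fun s : 'I_N * {set 'I_n} => cl_rat_coords (Kb s.1) s.2).
(* The product of all denominators, over every basis element and every coordinate. *)
pose D : int := \prod_s denq (q s).
have D0 : D != 0 by apply/prodf_neq0 => s _; rewrite denq_neq0.
have Dq s : exists z : int, D%:~R * q s = z%:~R.
  exists ((\prod_(t | t != s) denq (q t)) * numq (q s)).
  by rewrite /D (bigD1 s) //= !intrM numqE; ring.
exists (D%:~R ^+ 2); first by rewrite exprn_even_gt0 // intr_eq0.
move=> x /bO[z xE].
have Dx (A : {set 'I_n}) : exists w : int, D%:~R * x A = w%:~R * sqrt_weight A.
  rewrite xE sum_ffunE mulr_sumr.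
  elim/big_ind: _ => [|u v [r ->] [s ->]|i _].
  - by exists 0; rewrite mul0r.
  - by exists (r + s); rewrite intrD mulrDl.
  have [w wE] := Dq (i, A); exists (w * z i).
  rewrite -scaler_int ffunE (qE (i, A)) /= /GRing.scale /= intrM.
  have /(congr1 (ratr : rat -> R)) := wE; rewrite rmorphM !ratr_int => <-.
  ring.
have : exists w : int, D%:~R ^+ 2 * cl_norm x ^+ 2 = w%:~R.
  rewrite cl_norm_sqr mulr_sumr; elim/big_ind: _ => [|u v [r ->] [s ->]|A _].
  - by exists 0.
  - by exists (r + s); rewrite intrD.
  have [w wE] := Dx A; exists (w ^+ 2 * (\prod_(a in A) d a.+1)%:Z).
  by rewrite -exprMn wE exprMn sqrt_weight_sqr intrM rmorphXn.
move=> [w wE]; exists `|w|%N; rewrite wE natr_absz ger0_norm //.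
by rewrite -(ler0z R) -wE mulr_ge0 // sqr_ge0.
Qed.

(** If |x| < 1, the powers of x stay in O while the naturals M |x^k|^2 decrease strictly, which is
    impossible. *)
Lemma order_group_norm_ge1 (O : set C) x : is_order K O ->
  O x -> cl_group n x -> 1 <= cl_norm x.
Proof.
move=> ordO Ox Gx; rewrite leNgt; apply/negP => x1.
have [M M0 Mk] := order_norm_discrete ordO.
(* The descent passes from y to [y * x], starting at y = 1. *)
have descent (k : nat) y :
    O y -> cl_group n y -> M * cl_norm y ^+ 2 = k%:R -> False.
  elim/ltn_ind: k y => k IH y Oy Gy yk.
  have Oyx := orderM ordO Oy Ox.
  have [l lE] := Mk _ Oyx.
  apply: (IH l _ _ Oyx (cl_groupM Gy Gx) lE).
  have [y0 _ _] := cl_group_norm (leqnSn n) Gy.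
  rewrite -(ltr_nat R) -lE -yk (cl_group_normM (leqnSn n) Gy Gx) ltr_pM2l //.
  rewrite exprMn gtr_pMr ?exprn_gt0 //.
  by rewrite expr_lt1 ?cl_norm_ge0.
have [k kE] := Mk _ (order1 ordO).
by apply: descent (order1 ordO) _ kE; exact: cl_group1.
Qed.

Lemma order_group_norm1 (O : set C) x y : is_order K O ->
  O x -> O y -> cl_group n x -> cl_group n y -> x * y = 1 -> cl_norm x = 1.
Proof.
move=> ordO Ox Oy Gx Gy xy1; apply/eqP; rewrite eq_le.
have x1 := order_group_norm_ge1 ordO Ox Gx.
have y1 := order_group_norm_ge1 ordO Oy Gy.
have : cl_norm x * cl_norm y = 1.
  rewrite -(cl_group_normM (leqnSn n) Gx Gy) xy1.
  apply/eqP; rewrite -(@eqrXn2 _ 2) ?cl_norm_ge0 // expr1n.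
  by apply/eqP/cl_norm_scalar; rewrite cl_bar1 mulr1 scale1r.
by rewrite x1 andbT => <-; rewrite ler_peMr // cl_norm_ge0.
Qed.

End RationalCoordinates.

(** * Two by two matrices over a noncommutative ring *)

Section Matrix2.
Variable T : nzRingType.
Implicit Types (g h : 'M[T]_2) (a b c e : T).

Definition mx2 a b c e : 'M[T]_2 :=
  \matrix_(i, j) if i == 0 then if j == 0 then a else b
                 else if j == 0 then c else e.

Lemma mx2_00 a b c e : mx2 a b c e 0 0 = a. Proof. by rewrite mxE. Qed.
Lemma mx2_01 a b c e : mx2 a b c e 0 1 = b. Proof. by rewrite mxE. Qed.
Lemma mx2_10 a b c e : mx2 a b c e 1 0 = c. Proof. by rewrite mxE. Qed.
Lemma mx2_11 a b c e : mx2 a b c e 1 1 = e. Proof. by rewrite mxE. Qed.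

Definition mx2E := (mx2_00, mx2_01, mx2_10, mx2_11).

Lemma forall_ord2 (P : 'I_2 -> Prop) : P 0 -> P 1 -> forall i, P i.
Proof.
move=> P0 P1 [[|[|//]] im]; first by rewrite (_ : Ordinal im = 0) //; apply: val_inj.
by rewrite (_ : Ordinal im = 1) //; apply: val_inj.
Qed.

Lemma forall_mx2 (P : T -> Prop) g :
  P (g 0 0) -> P (g 0 1) -> P (g 1 0) -> P (g 1 1) -> forall i j, P (g i j).
Proof. by move=> ? ? ? ?; elim/forall_ord2; elim/forall_ord2. Qed.

Lemma mx2P g h : g 0 0 = h 0 0 -> g 0 1 = h 0 1 -> g 1 0 = h 1 0 ->
  g 1 1 = h 1 1 -> g = h.
Proof. by move=> ? ? ? ?; apply/matrixP; elim/forall_ord2; elim/forall_ord2. Qed.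

Lemma mulmx2E g h i j : (g *m h) i j = g i 0 * h 0 j + g i 1 * h 1 j.
Proof.
rewrite mxE !big_ord_recl big_ord0 addr0.
by rewrite (_ : lift ord0 ord0 = 1) //; apply: val_inj.
Qed.

Lemma mx2_1 : 1%:M = mx2 1 0 0 1.
Proof. by apply: mx2P; rewrite !mxE. Qed.

End Matrix2.

(** * Closure properties of the order and of the vector conditions *)

Section SL2Order.
Variables (R : realType) (n : nat) (d : nat -> nat).
Local Notation C := (clifford R n.+1).
Local Notation K := (@cl_rat R n d).
Local Notation V := (@cl_vec R n.+1 n).
Local Notation i_n := (cl_i R n.+1 n).
Variable O : set C.
Hypotheses (n0 : (0 < n)%N) (ordO : is_order K O).
Local Notation S := (@S_infty R n).
Implicit Types (g h : 'M[C]_2) (u v w x y : C).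

Let nn := leqnSn n.

Lemma order0 : O 0.
Proof. by rewrite -(subrr 1); apply: (orderB ordO); exact: (order1 ordO). Qed.

Lemma orderN x : O x -> O (- x).
Proof. by rewrite -sub0r; apply: (orderB ordO); exact: order0. Qed.

Lemma orderD x y : O x -> O y -> O (x + y).
Proof.
by move=> Ox Oy; rewrite -(opprK y); apply: (orderB ordO) => //; exact: orderN.
Qed.

Lemma order_mulmx g h : (forall i j, O (g i j)) -> (forall i j, O (h i j)) ->
  forall i j, O ((g *m h) i j).
Proof.
by move=> Og Oh i j; rewrite mulmx2E; apply: orderD; apply: (orderM ordO).
Qed.

Lemma cl_groupN x : cl_group n x -> cl_group n (- x).
Proof.
move=> Gx; rewrite -mulN1r; apply: cl_groupM => //; apply: cl_group_vec.
  exact/cl_vecN/cl_vec1.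
by rewrite oppr_eq0 oner_eq0.
Qed.

Lemma cl_group0N x : cl_group0 n x -> cl_group0 n (- x).
Proof. by case=> [Gx|->]; [left; exact: cl_groupN|right; rewrite oppr0]. Qed.

Lemma cl_vec_mul_star x y : V (x * cl_star y) -> V (y * cl_star x).
Proof. by move=> Vxy; rewrite -[y]cl_starK -cl_starM (cl_vec_star Vxy). Qed.

(* The second determinant identity says that the Clifford adjoint, a right
   inverse of g, is also a left inverse. *)
Lemma SL2_order_det2 g : in_SL2_order O g ->
  cl_star (g 0 0) * g 1 1 - cl_star (g 1 0) * g 0 1 = 1.
Proof.
case=> -[Gg det ab cd ca db] _ [h [gh hg _]].
pose a := mx2 (cl_star (g 1 1)) (- cl_star (g 0 1))
              (- cl_star (g 1 0)) (cl_star (g 0 0)).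
have ga : g *m a = 1%:M.
  rewrite mx2_1; apply: mx2P; rewrite mulmx2E !mx2E ?mulrN.
  - exact: det.
  - by rewrite -[X in - X](cl_vec_star ab) cl_starM cl_starK addNr.
  - by rewrite -[X in X - _](cl_vec_star cd) cl_starM cl_starK addrN.
  - have /(congr1 (@cl_star _ _)) := det; rewrite linearB /= !cl_starM !cl_starK.
    by rewrite cl_star1 addrC.
have ah : a = h by rewrite -[a]mul1mx -hg -mulmxA ga mulmx1.
have : (a *m g) 1 1 = 1 by rewrite ah hg mxE eqxx.
by rewrite mulmx2E !mx2E mulNr addrC.
Qed.

(** * Right multiplication by the inversion and by translations *)

Definition inversion : 'M[C]_2 := mx2 0 (-1) 1 0.
Definition translation v : 'M[C]_2 := mx2 1 v 0 1.

Lemma mulmx_inversion g :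
  g *m inversion = mx2 (g 0 1) (- g 0 0) (g 1 1) (- g 1 0).
Proof.
by apply: mx2P; rewrite mulmx2E !mx2E ?mulr0 ?mulr1 ?mulrN1 ?add0r ?addr0.
Qed.

Lemma mulmx_translation g v : g *m translation v =
  mx2 (g 0 0) (g 0 0 * v + g 0 1) (g 1 0) (g 1 0 * v + g 1 1).
Proof. by apply: mx2P; rewrite mulmx2E !mx2E ?mulr0 ?mulr1 ?addr0. Qed.

(** Separates the integrality of the product and of its inverse [l *m h] from the Clifford
    conditions, which are checked separately for the inversion and for translations. *)
Lemma SL2_order_mulr g (k l : 'M[C]_2) : in_SL2_order O g ->
    (forall i j, O (k i j)) -> (forall i j, O (l i j)) ->
    k *m l = 1%:M -> l *m k = 1%:M -> in_SL2 (g *m k) ->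
  in_SL2_order O (g *m k).
Proof.
move=> [_ Og [h [gh hg Oh]]] Ok Ol kl lk SLgk; split => //.
  exact: order_mulmx.
exists (l *m h); split; last exact: order_mulmx.
  by rewrite mulmxA -(mulmxA g) kl mulmx1.
by rewrite mulmxA -(mulmxA l) hg mulmx1.
Qed.

Lemma SL2_order_inversion g : in_SL2_order O g -> in_SL2_order O (g *m inversion).
Proof.
move=> SLg; have O0 := order0; have O1 := order1 ordO; have ON := orderN O1.
apply: (SL2_order_mulr (l := mx2 0 1 (-1) 0) SLg).
- by apply: forall_mx2; rewrite !mx2E.
- by apply: forall_mx2; rewrite !mx2E.
- by rewrite mx2_1; apply: mx2P; rewrite mulmx2E !mx2E
    !(mulr0, mul0r, mulr1, mulrN1, opprK, addr0, add0r).
- by rewrite mx2_1; apply: mx2P; rewrite mulmx2E !mx2E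
    !(mulr0, mul0r, mulr1, mulrN1, opprK, addr0, add0r).
case: SLg => -[Gg det ab cd ca db] _ _.
rewrite mulmx_inversion; split; rewrite ?mx2E ?linearN /= ?mulrN ?mulNr ?opprK //.
- by apply: forall_mx2; rewrite !mx2E //; apply: cl_group0N.
- by rewrite addrC.
- exact/cl_vecN/cl_vec_mul_star.
- exact/cl_vecN/cl_vec_mul_star.
Qed.

Lemma SL2_order_translation g v : V v -> O v ->
  in_SL2_order O g -> in_SL2_order O (g *m translation v).
Proof.
move=> Vv Ov SLg; have O0 := order0; have O1 := order1 ordO; have ON := orderN Ov.
have det2 := SL2_order_det2 SLg.
apply: (SL2_order_mulr (l := translation (- v)) SLg).
- by apply: forall_mx2; rewrite !mx2E.
- by apply: forall_mx2; rewrite !mx2E.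
- by rewrite mulmx_translation mx2_1 !mx2E mul1r mul0r addNr add0r.
- by rewrite mulmx_translation mx2_1 !mx2E mul1r mul0r addrN add0r.
case: SLg => -[Gg det ab cd ca db] _ _.
have entry x y : cl_group0 n x -> cl_group0 n y -> V (x * cl_star y) ->
    cl_group0 n (x * v + y).
  move=> [Gx|->] Gy Vxy; last by rewrite mul0r add0r.
  by apply: cl_group_addM => //; exact: (cl_vec_ratio nn).
have row x y : cl_group0 n x -> V (x * cl_star y) ->
    V (x * cl_star (x * v + y)).
  move=> Gx Vxy; rewrite linearD /= cl_starM (cl_vec_star Vv) mulrDr mulrA.
  apply: cl_vecD => //; case: Gx => [Gx|->]; first exact: (cl_group_conj nn).
  by rewrite !mul0r; exact: cl_vec0.
rewrite mulmx_translation; split; rewrite ?mx2E //.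
- by apply: forall_mx2; rewrite !mx2E //; apply: entry.
(* The two terms containing v are equal and cancel in the determinant. *)
- rewrite linearD /= cl_starM (cl_vec_star Vv) mulrDr mulrDl !mulrA.
  by rewrite opprD addrACA addrN add0r.
- exact: row.
- exact: row.
have {det2} det2 : cl_star (g 1 0) * g 0 1 = cl_star (g 0 0) * g 1 1 - 1.
  by rewrite -det2 opprB addrC subrK.
(* Write the bottom row as (c, c u) with u a vector, and let w be the vector [cl_star c * a], a
   being the upper left entry. The second determinant identity turns the product into (v + u) w (v +
   u) - (v + u), which is a vector by the sandwich lemma. *)
case: (Gg 1 0) => [Gc|c0].
  have cu := cl_group_unit nn Gc; have Vu := cl_vec_ratio nn Gc cd.
  set u := _^-1 * _ in Vu; have eE : g 1 1 = g 1 0 * u by rewrite mulVKr.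
  have Vvu := cl_vecD Vv Vu; set w := cl_star (g 1 0) * g 0 0.
  have wE : cl_star (g 0 0) * g 1 0 = w.
    by rewrite /w -(cl_vec_star ca) cl_starM cl_starK.
  have -> : cl_star (g 1 0 * v + g 1 1) * (g 0 0 * v + g 0 1) =
      (v + u) * w * (v + u) - (v + u).
    rewrite {1}eE -mulrDr cl_starM (cl_vec_star Vvu) -mulrA mulrDr mulrA -/w.
    rewrite det2 eE mulrA wE addrA -mulrDr mulrBr mulr1.
    by rewrite mulrA.
  by apply: cl_vecB => //; apply: (cl_vec_sandwich nn).
(* For c = 0 the product reduces to v plus the old value. *)
have {det2} det2 : cl_star (g 1 1) * g 0 0 = 1.
  apply: (can_inj (@cl_starK _ _)); rewrite cl_starM cl_starK cl_star1.
  by apply/eqP; rewrite -subr_eq0 -det2 c0 linear0 mul0r.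
by rewrite c0 mul0r add0r mulrDr mulrA det2 mul1r; apply: cl_vecD.
Qed.

(** * Action on the horosphere at height 1 *)

Lemma S_infty_addr v x : V v -> S x -> S (x + v).
Proof.
move=> Vv /(S_inftyP n0)[u Vu ->]; apply/(S_inftyP n0).
by exists (u + v); [exact: cl_vecD|rewrite addrAC].
Qed.

Lemma S_infty_i : S i_n.
Proof. by apply/(S_inftyP n0); exists 0; [exact: cl_vec0|rewrite add0r]. Qed.

Lemma mobius_translation g v x :
  mobius (g *m translation v) x = mobius g (x + v).
Proof. by rewrite /mobius mulmx_translation !mx2E !mulrDr !addrA. Qed.

Lemma sphere_translation g v : V v ->
  mobius (g *m translation v) @` S = mobius g @` S.
Proof.
move=> Vv; apply/seteqP; split=> _ [x Sx <-].
  by exists (x + v); [exact: S_infty_addr|rewrite mobius_translation].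
exists (x - v); first by apply: S_infty_addr => //; exact: cl_vecN.
by rewrite mobius_translation subrK.
Qed.

(** [^-1] is total and returns non-units unchanged, so the value at i_n is a true quotient only with
    a unit denominator. If c is nonzero, the denominator is c times a vector with i_n-coordinate 1;
    if c = 0, it is the lower right entry, nonzero by the determinant. *)
Lemma SL2_denom_unit g : in_SL2 g -> g 1 0 * i_n + g 1 1 \is a GRing.unit.
Proof.
case=> Gg det _ cd _ _; case: (Gg 1 0) => [Gc|c0].
  have cu := cl_group_unit nn Gc; have Vu := cl_vec_ratio nn Gc cd.
  have [Sv vn] : S ((g 1 0)^-1 * g 1 1 + i_n).
    by apply/(S_inftyP n0); exists ((g 1 0)^-1 * g 1 1).
  rewrite -[g 1 1](mulVKr cu) -mulrDr unitrMr // addrC.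
  apply: (@cl_group_unit _ _ n.+1) => //; apply: cl_group_vec => //.
  apply/eqP => v0; move/eqP: vn; rewrite v0 /cl_coord ffunE eq_sym.
  by rewrite oner_eq0.
rewrite c0 mul0r add0r; case: (Gg 1 1) => [|e0]; first exact: cl_group_unit.
move: det; rewrite c0 e0 !linear0 !mulr0 subr0 => /esym/eqP.
by rewrite oner_eq0.
Qed.

(** The inversion fixes i_n: as i_n squares to -1, it multiplies numerator and denominator on the
    right by i_n, which cancels. *)
Lemma mobius_inversion g : in_SL2 g -> mobius (g *m inversion) i_n = mobius g i_n.
Proof.
move=> SLg; have iu := cl_i_unit R n0.
have ii : i_n * i_n = -1 by rewrite cl_i_sqr // n0 /=.
have E x y : y * i_n - x = (x * i_n + y) * i_n.
  by rewrite mulrDl -mulrA ii mulrN1 addrC.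
rewrite /mobius mulmx_inversion !mx2E !E invrM ?SL2_denom_unit //.
by rewrite mulrA mulrK.
Qed.

Lemma sphere_upper g : star_closed O -> in_SL2_order O g -> g 1 0 = 0 ->
  mobius g @` S = S.
Proof.
move=> starO [[Gg det ab _ _ _] Og _] c0.
move: det; rewrite c0 linear0 mulr0 subr0 => ae1.
have Ga : cl_group n (g 0 0).
  case: (Gg 0 0) => // a0; move: ae1; rewrite a0 mul0r => /esym/eqP.
  by rewrite oner_eq0.
have au := cl_group_unit nn Ga; have [asu asV] := cl_star_unitV au.
have esE : cl_star (g 1 1) = (g 0 0)^-1 by rewrite -[LHS](mulKr au) ae1 mulr1.
have eV : (g 1 1)^-1 = cl_star (g 0 0).
  by rewrite -[g 1 1]cl_starK esE asV invrK.
(* The inverse of a is the reversal of the lower right entry, hence lies in O because O is closed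
   under reversal. *)
have a1 : cl_norm (g 0 0) = 1.
  apply: (order_group_norm1 ordO (y := (g 0 0)^-1)) => //; last exact: mulrV.
  - by rewrite -esE; exact: starO.
  - exact: cl_groupV.
have gE v : mobius g (v + i_n) =
    g 0 0 * v * cl_star (g 0 0) + g 0 1 * cl_star (g 0 0) + i_n.
  rewrite /mobius c0 mul0r add0r eV mulrDr !mulrDl (cl_group_conj_i n0 Ga).
  by rewrite a1 expr1n scale1r addrAC.
have Vba := cl_vec_mul_star ab.
apply/seteqP; split=> [_ [x /(S_inftyP n0)[v Vv ->] <-]|x /(S_inftyP n0)[v Vv ->]].
  apply/(S_inftyP n0); rewrite gE; eexists; last by [].
  by apply: cl_vecD => //; exact: (cl_group_conj nn).
(* Surjectivity: subtract the translation part, then act by the inverse of a to get the preimage. *)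
have Vw : V (v - g 0 1 * cl_star (g 0 0)) by exact: cl_vecB.
have := cl_group_conj nn (cl_groupV Ga) Vw; rewrite asV => Vu.
eexists; first by apply/(S_inftyP n0); eexists; [exact: Vu|].
by rewrite gE !mulrA mulrV // mul1r mulrVK // subrK.
Qed.

(** * Chains of tangent Ford spheres *)

Local Notation step :=
  (fun s t => [/\ ford_spheres O s, ford_spheres O t & @tangent R n s t]).
Local Notation linked := (clos_refl_trans _ step).

(** Adjacency requires distinct spheres, so the case where the two coincide is settled by
    reflexivity. Both directions are recorded because the closure is not symmetric by
    construction. *)
Lemma linked_inversion g : in_SL2_order O g ->
  linked (mobius g @` S) (mobius (g *m inversion) @` S) /\
  linked (mobius (g *m inversion) @` S) (mobius g @` S).
Proof.
move=> SLg; have SLgJ := SL2_order_inversion SLg.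
have [->|neq] := pselect (mobius g @` S = mobius (g *m inversion) @` S).
  by split; exact: rt_refl.
have m1 : (mobius g @` S) (mobius g i_n) by exists i_n => //; exact: S_infty_i.
have m2 : (mobius (g *m inversion) @` S) (mobius g i_n).
  exists i_n; first exact: S_infty_i.
  by apply: mobius_inversion; case: SLg.
have Fg : ford_spheres O (mobius g @` S) by exists g.
have FgJ : ford_spheres O (mobius (g *m inversion) @` S) by exists (g *m inversion).
split; apply: rt_step; split => //; split; try by exists (mobius g i_n).
- exact: neq.
- by move=> E; exact: neq.
Qed.

Lemma linked_S_infty g : star_closed O -> clifford_euclidean K O ->
  in_SL2_order O g ->
  linked S (mobius g @` S) /\ linked (mobius g @` S) S.
Proof.
move=> starO euclO; have [M M0 Mk] := order_norm_discrete ordO.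
move=> SLg; have [k] : exists k : nat, M * cl_norm (g 1 0) ^+ 2 = k%:R.
  by apply: Mk; case: SLg.
(* Strong induction on M |c|^2, with c the lower left entry. *)
elim/ltn_ind: k g SLg => k IH g SLg ck.
have upper h : in_SL2_order O h -> h 1 0 = 0 ->
    linked S (mobius h @` S) /\ linked (mobius h @` S) S.
  by move=> SLh h0; rewrite sphere_upper //; split; exact: rt_refl.
have via h : mobius h @` S = mobius g @` S -> in_SL2_order O h ->
    linked S (mobius (h *m inversion) @` S) /\
    linked (mobius (h *m inversion) @` S) S ->
    linked S (mobius g @` S) /\ linked (mobius g @` S) S.
  move=> <- /linked_inversion[L1 L2] [L3 L4].
  by split; [exact: rt_trans L3 L2|exact: rt_trans L1 L4].
have [[Gg _ _ cd _ _] Og _] := SLg.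
case: (Gg 1 0) => [Gc|/(upper g SLg) //].
(* The Euclidean condition asks for an invertible quotient, so e = 0 is treated apart: one inversion
   then makes the lower left entry 0. *)
case: (Gg 1 1) => [Ge|e0]; last first.
  apply: (via g) => //; apply: upper; first exact: SL2_order_inversion.
  by rewrite mulmx_inversion mx2E.
have cu := cl_group_unit nn Gc; have eu := cl_group_unit nn Ge.
have [a [r [[Oa Va] eE rc]]] : exists a r, [/\ order_vec O a,
    g 1 1 = g 1 0 * a + r & cl_norm r < cl_norm (g 1 0)].
  apply: euclO; try by split => //; left.
  - split; last exact: (cl_vec_ratio nn).
    apply: cl_ratM; last exact: (order_sub ordO).
    by apply: cl_rat_group_inv => //; exact: (order_sub ordO).
  - by rewrite unitrMr ?unitrV.
have VNa := cl_vecN Va; have ONa := orderN Oa.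
have SLh := SL2_order_translation VNa ONa SLg.
apply: (via _ (sphere_translation g VNa) SLh).
set h := g *m translation (- a) in SLh *.
have SLhJ := SL2_order_inversion SLh.
(* The translation turns the bottom row (c, e) into (c, r), and the inversion moves r to the lower
   left. *)
have hE : (h *m inversion) 1 0 = r.
  rewrite mulmx_inversion !mx2E /h mulmx_translation !mx2E eE mulrN.
  by rewrite addrA addNr add0r.
have [l lE] : exists l : nat, M * cl_norm r ^+ 2 = l%:R.
  by apply: Mk; rewrite -hE; case: SLhJ.
apply: (IH l) => //; last by rewrite hE.
by rewrite -(ltr_nat R) -lE -ck ltr_pM2l // ltr_pXn2r ?nnegrE ?cl_norm_ge0 //.
Qed.

End SL2Order.

Theorem mainTheorem7 (R : realType) (n : nat) (d : nat -> nat)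
    (O : set (clifford R n.+1)) :
  (0 < n)%N ->
  (forall j, (0 < j < n)%N -> (0 < d j)%N /\ squarefree (d j)) ->
  primitive_form n d ->
  is_order (@cl_rat R n d) O ->
  star_closed O ->
  clifford_euclidean (@cl_rat R n d) O ->
  connected_graph (ford_spheres O) (@tangent R n).
Proof.
move=> n0 _ _ ordO starO euclO _ _ [g SLg ->] [h SLh ->].
(* Both spheres are joined to [S_infty], through which the chain passes. *)
have [_ L1] := linked_S_infty n0 ordO starO euclO SLg.
have [L2 _] := linked_S_infty n0 ordO starO euclO SLh.
exact: rt_trans L1 L2.
Qed.
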